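(* Let $n\ge 2$ be an integer, let $A_1A_2\ldots A_{n+1}$ be an $n$-simplex and let $M$ be any point in its interior. For $1\le i\le n+1$ let $N_i$ be the point on the hyperplane opposite $A_i$ (the hyperplane through all vertices other than $A_i$) such that $A_i$, $M$, $N_i$ are collinear. Let $V$ be the volume of $A_1A_2\ldots A_{n+1}$ and, for $1\le i\le n+1$, let $V_i$ be the volume of the simplex $MN_1N_2\ldots N_{i-1}N_{i+1}\ldots N_{n+1}$. Then for every integer $k$ with $1<k<n$, $$ \frac{V_1+V_2+\cdots+V_k}{V}\le \frac{k\theta^k}{(1-\theta)^{k-1}}\cdot\left(\frac{1-k\theta}{m-1+k\theta}\right)^{m}, $$ where $m=n+1-k$ and $\theta$ is the zero of the cubic $$ q(x)=k^{2}x^{3}-k(k^{2}-m^{2}-m+2)x^{2}+(2k^{2}-k^{2}m-km^{2}-m+1)x+k(m-1) $$ in the interval $\left(0,\frac{1}{k}\right)$. Equality holds when $M$ is the point with barycentric coordinates $\lambda_1=\lambda_2=\cdots=\lambda_k=\theta$, $\lambda_{k+1}=\lambda_{k+2}=\cdots=\lambda_{n+1}=\frac{1-k\theta}{m}$ with respect to $A_1A_2\ldots A_{n+1}$.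
   Context: Barycentric coordinates $(\lambda_1,\ldots,\lambda_{n+1})$ of $M$ with respect to the simplex $A_1A_2\ldots A_{n+1}$ are normalized so that $\lambda_1+\cdots+\lambda_{n+1}=1$, i.e. $M=\sum_{i}\lambda_iA_i$. The volume of an $n$-simplex is its (unsigned) $n$-dimensional volume; $MN_1\ldots N_{i-1}N_{i+1}\ldots N_{n+1}$ denotes the simplex with vertices $M$ and all $N_j$ with $j\ne i$. *)

(* Defs.v *)
(* R^n is 'rV[R]_n; the vertices A_1, ..., A_(n+1) are indexed from 0,
   by 'I_n.+1. *)
From HB Require Import structures.
From mathcomp Require Import all_boot all_order all_algebra.
From mathcomp Require Import all_classical all_reals all_analysis.

Set Implicit Arguments.
Unset Strict Implicit.
Unset Printing Implicit Defensive.

Import Order.TTheory GRing.Theory Num.Theory.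
Import numFieldNormedType.Exports.

Local Open Scope classical_set_scope.
Local Open Scope ring_scope.

Definition barycentric (R : realType) (n p : nat) (A : 'I_p -> 'rV[R]_n)
    (lam : 'I_p -> R) (P : 'rV[R]_n) : Prop :=
  \sum_i lam i = 1 /\ P = \sum_i lam i *: A i.

Definition affinely_independent (R : realType) (n p : nat)
    (A : 'I_p -> 'rV[R]_n) : Prop :=
  forall c : 'I_p -> R,
    \sum_i c i = 0 -> \sum_i c i *: A i = 0 -> forall i, c i = 0.

(* The closed convex hull of the vertices; they may be affinely dependent. *)
Definition simplex (R : realType) (n p : nat) (A : 'I_p -> 'rV[R]_n) :
    set 'rV[R]_n :=
  [set P | exists2 lam : 'I_p -> R,
             (forall i, 0 <= lam i) & barycentric A lam P].

Definition opposite_hyperplane (R : realType) (n p : nat)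
    (A : 'I_p -> 'rV[R]_n) (i : 'I_p) : set 'rV[R]_n :=
  [set P | exists2 c : 'I_p -> R, c i = 0 & barycentric A c P].

Definition collinear (R : realType) (n : nat) (P Q S : 'rV[R]_n) : Prop :=
  exists O u : 'rV[R]_n, exists a b c : R,
    [/\ P = O + a *: u, Q = O + b *: u & S = O + c *: u].

Definition box (R : realType) (n : nat) (a b : 'rV[R]_n) : set 'rV[R]_n :=
  [set x | forall j, a 0 j <= x 0 j <= b 0 j].

(* n-dimensional Lebesgue (outer) measure: the infimum of the total volumes of
   countable covers by closed boxes.  Simplices are compact, hence Lebesgue
   measurable, so that for them this is the Lebesgue measure. *)
Definition lebesgue_vol (R : realType) (n : nat) (S : set 'rV[R]_n) : \bar R :=
  ereal_inf [set s | exists a b : nat -> 'rV[R]_n,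
    [/\ forall l j, a l 0 j <= b l 0 j,
        S `<=` \bigcup_l box (a l) (b l) &
        s = (\sum_(0 <= l <oo) (\prod_j (b l 0 j - a l 0 j))%:E)%E]].

Definition simplex_vol (R : realType) (n p : nat) (A : 'I_p -> 'rV[R]_n) : R :=
  fine (lebesgue_vol (simplex A)).

Definition cevian_feet (R : realType) (n p : nat) (A : 'I_p -> 'rV[R]_n)
    (M : 'rV[R]_n) (N : 'I_p -> 'rV[R]_n) : Prop :=
  forall i, opposite_hyperplane A i (N i) /\ collinear (A i) M (N i).

(* The vertices M, N_j (j != i): M takes the place of N_i. *)
Definition cevian_subsimplex (R : realType) (n p : nat) (M : 'rV[R]_n)
    (N : 'I_p -> 'rV[R]_n) (i : 'I_p) : 'I_p -> 'rV[R]_n :=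
  fun j => if j == i then M else N j.

Definition q (R : realType) (k m : nat) (x : R) : R :=
  let k := k%:R : R in
  let m := m%:R : R in
  k ^+ 2 * x ^+ 3 - k * (k ^+ 2 - m ^+ 2 - m + 2) * x ^+ 2
  + (2 * k ^+ 2 - k ^+ 2 * m - k * m ^+ 2 - m + 1) * x + k * (m - 1).

Definition q_zero (R : realType) (k m : nat) (theta : R) : Prop :=
  0 < theta < k%:R^-1 /\ q k m theta = 0.

Definition volume_ratio (R : realType) (n k : nat) (A : 'I_n.+1 -> 'rV[R]_n)
    (M : 'rV[R]_n) (N : 'I_n.+1 -> 'rV[R]_n) : R :=
  (\sum_(i < n.+1 | (i < k)%N) simplex_vol (cevian_subsimplex M N i))
  / simplex_vol A.

Definition bound (R : realType) (k m : nat) (theta : R) : R :=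
  k%:R * theta ^+ k / (1 - theta) ^+ k.-1
  * ((1 - k%:R * theta) / (m%:R - 1 + k%:R * theta)) ^+ m.

(* Main.v *)
Require Import Defs.
From mathcomp Require Import all_boot all_order all_algebra.
From mathcomp Require Import all_classical all_reals all_analysis.
From mathcomp Require Import measurable_realfun ring lra.
Import Order.TTheory GRing.Theory Num.Theory.
Import numFieldNormedType.Exports.
Local Open Scope classical_set_scope.
Local Open Scope ring_scope.

(** Write [lam] for the barycentric coordinates of [M]; they are positive.  The
    foot [N_j] is [(M - lam_j A_j) / (1 - lam_j)], so the matrix expressing the
    vertices of the [i]-th subsimplex in terms of the [A_j] is explicit, and its
    determinant is, up to sign, [(1 - lam_i) * \prod_j lam_j / (1 - lam_j)]
    ([det_cevian_mx]).  Since the volume of a simplex is multiplied by the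
    absolute value of this determinant ([simplex_vol_ratio]), the ratio to be
    bounded is
      [(\sum_(i < k) (1 - lam_i)) * \prod_j lam_j / (1 - lam_j)].

    For the volume, the outer measure [lebesgue_vol] is shown to be multiplied by
    [|det L|] under an invertible linear map [L] ([scales_vol_unitmx]): Gaussian
    elimination reduces the claim to diagonal matrices, which map boxes to boxes,
    and to transvections, for which a box is cut into thin slices whose images
    nearly are boxes.  A simplex is an affine image of the standard simplex,
    whose outer measure is positive because a box has at least its elementary
    volume ([lebesgue_vol_box_ge], by integration over the first coordinate).

    The inequality rests on the concavity of the logarithm, used twice.  First,
    Jensen's inequality for [1 - lam_i], the sum of the other coordinates, shows
    that replacing the coordinates of the block [i < k], or those of the block
    [i >= k], by their mean does not decrease the product
    ([sum_logit_le_mean]).  This leaves the function [two_block] of the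
    mean [t] of the first block.  Second, Jensen's inequality for [1 - t],
    [1 - u] and [k t + m u = 1] bounds the change of [ln two_block] from [theta]
    to [t] by a combination of [ln (t / theta)] and [ln (u / mu)]; the equation
    [q theta = 0] is what makes the combination equal to the nonpositive quantity
    [k theta ln (t / theta) + m mu ln (u / mu)] ([two_block_le]). *)

(** * The outer measure by boxes *)

(** The elementary volume of the closed box [box a b]; it is meaningful when
    [a <= b] coordinatewise. *)
Definition box_vol {R : realType} {n : nat} (a b : 'rV[R]_n) : R :=
  \prod_j (b 0 j - a 0 j).

Lemma box_vol_ge0 {R : realType} {n : nat} (a b : 'rV[R]_n) :
  (forall j, a 0 j <= b 0 j) -> 0 <= box_vol a b.
Proof. by move=> ab; apply: prodr_ge0 => j _; rewrite subr_ge0. Qed.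

Lemma lebesgue_vol_ge0 {R : realType} {n : nat} (S : set 'rV[R]_n) :
  (0 <= lebesgue_vol S)%E.
Proof.
apply: le_ereal_inf_tmp => _ [a [b [ab _ ->]]].
by apply: nneseries_ge0 => l _ _; rewrite lee_fin box_vol_ge0.
Qed.

Lemma le_lebesgue_vol {R : realType} {n : nat} (S T : set 'rV[R]_n) :
  S `<=` T -> (lebesgue_vol S <= lebesgue_vol T)%E.
Proof.
move=> ST; apply: ereal_inf_le_tmp => _ [a [b [ab Tab ->]]].
by exists a, b; split => //; exact: subset_trans Tab.
Qed.

Lemma lebesgue_vol_sigma_subadditive {R : realType} {n : nat}
    (S : nat -> set 'rV[R]_n) :
  (lebesgue_vol (\bigcup_l S l) <= \sum_(0 <= l <oo) lebesgue_vol (S l))%E.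
Proof.
(* If every volume is finite, cover S l up to e / 2 ^ l.+1 and enumerate the
   doubly indexed family of boxes. *)
have [[i ioo]|] := pselect (exists i, lebesgue_vol (S i) = +oo%E).
  rewrite (eseries_pinfty _ _ ioo) ?leey// => l _.
  by rewrite -ltNye (lt_le_trans _ (lebesgue_vol_ge0 _)).
rewrite -forallNE => Soo.
apply/lee_addgt0Pr => e e0.
apply: le_trans (epsilon_trick _ (fun l => lebesgue_vol_ge0 (S l)) (ltW e0)).
pose P l (ab : (nat -> 'rV[R]_n) * (nat -> 'rV[R]_n)) :=
  [/\ forall i j, ab.1 i 0 j <= ab.2 i 0 j,
      S l `<=` \bigcup_i box (ab.1 i) (ab.2 i) &
   (\sum_(0 <= i <oo) (box_vol (ab.1 i) (ab.2 i))%:E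
     <= lebesgue_vol (S l) + (e / (2 ^ l.+1)%:R)%:E)%E].
have [G PG] : {G & forall l, P l (G l)}.
  apply: choice => l.
  have fin : lebesgue_vol (S l) \is a fin_num.
    by rewrite ge0_fin_numE ?lebesgue_vol_ge0// ltey; apply/eqP/Soo.
  have el : 0 < e / (2 ^ l.+1)%:R by rewrite divr_gt0// ltr0n expn_gt0.
  have [_ [a [b [ab Sab ->]]] lt] := lb_ereal_inf_adherent el fin.
  by exists (a, b); split => //; exact: ltW.
pose v (p : nat * nat) : \bar R := (box_vol ((G p.1).1 p.2) ((G p.1).2 p.2))%:E.
have v0 p : (0 <= v p)%E.
  by rewrite lee_fin box_vol_ge0// => j; have [+ _ _] := PG p.1; exact.
apply: (@le_trans _ _ (\sum_(0 <= l <oo) \sum_(0 <= i <oo) v (l, i))%E); last first.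
  apply: lee_nneseries => [l _ _|l _]; first by apply: nneseries_ge0.
  by have [_ _] := PG l.
have -> : (\sum_(0 <= l <oo) \sum_(0 <= i <oo) v (l, i) =
    \esum_(p in [set: nat * nat]) v p)%E.
  rewrite nneseries_esumT; last by move=> l; apply: nneseries_ge0.
  under eq_esum => l _ do rewrite nneseries_esumT//.
  rewrite (@esum_esum _ _ _ [set: nat] (fun=> [set: nat]) (fun l i => v (l, i)))//.
  have -> : [set: nat] `*`` (fun=> [set: nat]) = [set: nat * nat].
    by apply/seteqP; split.
  by apply: eq_esum => -[].
have /card_esym/ppcard_eqP[f] := card_nat2.
rewrite (reindex_esum [set: nat] [set: nat * nat] f)//.
rewrite -nneseries_esumT//.
apply: ereal_inf_lbound => /=.
exists (fun l => (G (f l).1).1 (f l).2), (fun l => (G (f l).1).2 (f l).2).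
split => //.
- by move=> l j; have [+ _ _] := PG (f l).1; exact.
- move=> x [l _ Slx]; have [_ + _] := PG l => /(_ _ Slx)[i _ xi].
  by exists (f^-1%FUN (l, i)) => //=; rewrite invK ?inE.
Qed.

Lemma lebesgue_vol_box_le {R : realType} {n : nat} (a b : 'rV[R]_n) :
  (0 < n)%N -> (forall j, a 0 j <= b 0 j) ->
  (lebesgue_vol (box a b) <= (box_vol a b)%:E)%E.
Proof.
move=> n0 ab; apply: ereal_inf_lbound => /=.
(* The degenerate boxes [box 0 0] have volume 0 because 0 < n. *)
exists (fun l => if l == 0%N then a else 0), (fun l => if l == 0%N then b else 0).
split=> [[|l]//||]; first by move=> x xab; exists 0%N.
rewrite (@nneseries_split _ _ 0 1); last first.
  by move=> [|l] _; rewrite lee_fin box_vol_ge0.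
rewrite big_nat1 eseries0 ?adde0// => -[|l]// _ _.
by rewrite (bigD1 (Ordinal n0))//= mxE subrr mul0r.
Qed.

Lemma lebesgue_vol_set0 {R : realType} {n : nat} :
  (0 < n)%N -> lebesgue_vol (set0 : set 'rV[R]_n) = 0%E.
Proof.
move=> n0; apply/eqP; rewrite eq_le lebesgue_vol_ge0 andbT.
apply: le_trans (le_lebesgue_vol _ (box 0 0) _) _ => //.
apply: le_trans (lebesgue_vol_box_le _ _ n0 _) _ => //.
by rewrite lee_fin /box_vol (bigD1 (Ordinal n0))//= subrr mul0r.
Qed.

Lemma lebesgue_vol_bigcup_ord {R : realType} {n : nat} (N : nat)
    (S : nat -> set 'rV[R]_n) : (0 < n)%N ->
  (lebesgue_vol (\bigcup_(l in [set l | (l < N)%N]) S l)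
    <= \sum_(l < N) lebesgue_vol (S l))%E.
Proof.
move=> n0; pose S' l := if (l < N)%N then S l else set0.
have -> : \bigcup_(l in [set l | (l < N)%N]) S l = \bigcup_l S' l.
  apply/seteqP; split => [x [l /= lN xS]|x [l _]].
    by exists l => //; rewrite /S' lN.
  by rewrite /S'; case: ifPn => // lN xS; exists l.
apply: le_trans (lebesgue_vol_sigma_subadditive S') _.
rewrite (@nneseries_split _ _ 0 N); last by move=> l _; exact: lebesgue_vol_ge0.
rewrite add0n big_mkord eseries0 ?adde0; last first.
  by move=> l Nl _; rewrite /S' ltnNge Nl lebesgue_vol_set0.
by apply: lee_sum => l _; rewrite /S' ltn_ord.
Qed.

Lemma lebesgue_vol_image_le {R : realType} {n p : nat}
    (f : 'rV[R]_n -> 'rV[R]_p) (c : R) : 0 < c ->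
  (forall a b : 'rV[R]_n, (forall j, a 0 j <= b 0 j) ->
     (lebesgue_vol (f @` box a b) <= (c * box_vol a b)%:E)%E) ->
  forall S : set 'rV[R]_n, (lebesgue_vol (f @` S) <= c%:E * lebesgue_vol S)%E.
Proof.
move=> c0 fbox S; rewrite -lee_pdivrMl//.
apply: le_ereal_inf_tmp => _ [a [b [ab Sab ->]]].
rewrite lee_pdivrMl// -nneseriesZl; last first.
  by move=> l _; rewrite lee_fin box_vol_ge0.
apply: (@le_trans _ _ (lebesgue_vol (\bigcup_l (f @` box (a l) (b l))))).
  by apply: le_lebesgue_vol => _ [x /Sab[l _ xl] <-]; exists l => //; exists x.
apply: le_trans (lebesgue_vol_sigma_subadditive _) _.
apply: lee_nneseries => [l _ _|l _]; first exact: lebesgue_vol_ge0.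
by rewrite -EFinM; apply: fbox.
Qed.

(** * Volume and linear maps *)

Lemma lebesgue_vol_translate {R : realType} {n : nat} (v : 'rV[R]_n)
    (S : set 'rV[R]_n) :
  (0 < n)%N -> lebesgue_vol ((fun x => x + v) @` S) = lebesgue_vol S.
Proof.
move=> n0.
have le (w : 'rV[R]_n) (T : set 'rV[R]_n) :
    (lebesgue_vol ((fun x => x + w)%R @` T) <= lebesgue_vol T)%E.
  rewrite -[leRHS]mul1e; apply: lebesgue_vol_image_le => // a b ab.
  rewrite mul1r; have -> : box_vol a b = box_vol (a + w) (b + w).
    by apply: eq_bigr => j _; rewrite !mxE; ring.
  apply: le_trans (lebesgue_vol_box_le _ _ n0 _); last first.
    by move=> j; rewrite !mxE lerD2r.
  by apply: le_lebesgue_vol => _ [x xab <-] j; rewrite !mxE !lerD2r.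
apply/eqP; rewrite eq_le le /=.
apply: le_trans (le (- v) _); apply: le_lebesgue_vol => x xS.
by exists (x + v); [exists x|rewrite addrK].
Qed.

(** The linear map with matrix [L] (acting on row vectors) multiplies all
    volumes by the absolute value of its determinant. *)
Definition scales_vol {R : realType} {n : nat} (L : 'M[R]_n) : Prop :=
  forall S : set 'rV[R]_n,
    lebesgue_vol (mulmx^~ L @` S) = (`|\det L|%:E * lebesgue_vol S)%E.

Lemma image_mulmx {R : realType} {n : nat} (L L' : 'M[R]_n)
    (S : set 'rV[R]_n) :
  mulmx^~ L' @` (mulmx^~ L @` S) = mulmx^~ (L *m L') @` S.
Proof.
rewrite image_comp; congr (_ @` S).
by apply/funext => x /=; rewrite mulmxA.
Qed.

Lemma image_mulmx1 {R : realType} {n : nat} (S : set 'rV[R]_n) :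
  mulmx^~ 1%:M @` S = S.
Proof.
by rewrite (_ : mulmx^~ _ = id) ?image_id//; apply/funext => x; rewrite mulmx1.
Qed.

(** An upper bound on volumes for a matrix and for its inverse is enough. *)
Lemma scales_vol_le {R : realType} {n : nat} (L L' : 'M[R]_n) :
  L *m L' = 1%:M ->
  (forall S, lebesgue_vol (mulmx^~ L @` S) <= `|\det L|%:E * lebesgue_vol S)%E ->
  (forall S, lebesgue_vol (mulmx^~ L' @` S) <= `|\det L'|%:E * lebesgue_vol S)%E ->
  scales_vol L.
Proof.
move=> LL' leL leL' S; apply/eqP; rewrite eq_le leL /=.
have dLL' : \det L * \det L' = 1 by rewrite -det_mulmx LL' det1.
have := leL' (mulmx^~ L @` S); rewrite image_mulmx LL' image_mulmx1.
move=> /(lee_wpmul2l (x := `|\det L|%:E)); rewrite lee_fin normr_ge0 => /(_ isT).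
by rewrite muleA -EFinM -normrM dLL' normr1 mul1e.
Qed.

Lemma scales_vol_mul {R : realType} {n : nat} (L L' : 'M[R]_n) :
  scales_vol L -> scales_vol L' -> scales_vol (L *m L').
Proof.
move=> sL sL' S; rewrite -image_mulmx sL' sL muleA -EFinM -normrM.
by rewrite det_mulmx mulrC.
Qed.

Lemma scales_vol_cancel {R : realType} {n : nat} (E L : 'M[R]_n) :
  E \in unitmx -> scales_vol E -> scales_vol (E *m L) -> scales_vol L.
Proof.
move=> uE sE sEL S.
have -> : S = mulmx^~ E @` (mulmx^~ (invmx E) @` S).
  by rewrite image_mulmx mulVmx// image_mulmx1.
move: (mulmx^~ (invmx E) @` S) => T.
rewrite image_mulmx sEL sE det_mulmx muleA -EFinM -normrM.
by congr (`|_|%:E * _)%E; rewrite mulrC.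
Qed.

Lemma diag_mx_vol_le {R : realType} {n : nat} (d : 'rV[R]_n) :
  (0 < n)%N -> (forall j, d 0 j != 0) -> forall S : set 'rV[R]_n,
  (lebesgue_vol (mulmx^~ (diag_mx d) @` S)
    <= `|\det (diag_mx d)|%:E * lebesgue_vol S)%E.
Proof.
move=> n0 d0; apply: lebesgue_vol_image_le.
  by rewrite normr_gt0 det_diag; apply/prodf_neq0.
move=> a b ab.
pose u := \row_j Num.min (d 0 j * a 0 j) (d 0 j * b 0 j).
pose w := \row_j Num.max (d 0 j * a 0 j) (d 0 j * b 0 j).
have -> : `|\det (diag_mx d)| * box_vol a b = box_vol u w.
  rewrite det_diag normr_prod -big_split/=; apply: eq_bigr => j _.
  rewrite !mxE; case: (ltrgt0P (d 0 j)) (d0 j) => // dj _.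
    have := ab j; rewrite -(ler_pM2l dj) => ?.
    by rewrite max_r// min_l// mulrBr.
  have := ab j; rewrite -(ler_nM2l dj) => ?.
  by rewrite max_l// min_r// mulrBr; ring.
apply: le_trans (lebesgue_vol_box_le _ _ n0 _); last first.
  by move=> j; rewrite !mxE ge_min le_max lexx.
apply: le_lebesgue_vol => _ [x xab <-] j; rewrite mul_mx_diag !mxE.
have /andP[ax xb] := xab j; rewrite ge_min le_max ![x 0 j * _]mulrC.
by case: (ltrgt0P (d 0 j)) (d0 j) => // dj _;
  rewrite ?(ler_pM2l dj) ?(ler_nM2l dj) ax xb ?orbT.
Qed.

Lemma scales_vol_diag {R : realType} {n : nat} (d : 'rV[R]_n) :
  (0 < n)%N -> (forall j, d 0 j != 0) -> scales_vol (diag_mx d).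
Proof.
move=> n0 d0; apply: (@scales_vol_le _ _ _ (diag_mx (\row_j (d 0 j)^-1))).
- apply/matrixP => i j; rewrite mul_diag_mx !mxE.
  by case: eqP => [->|_]; rewrite ?mulr1n ?divff// mulr0n mulr0.
- exact: diag_mx_vol_le.
- by apply: diag_mx_vol_le => // j; rewrite mxE invr_eq0.
Qed.

(** The matrix of the map [x |-> x + c * x_i e_j]. *)
Definition transvection {R : realType} {n : nat} (i j : 'I_n) (c : R) : 'M[R]_n :=
  1%:M + c *: delta_mx i j.

Lemma mulmx_transvection {R : realType} {n : nat} (i j : 'I_n) (c : R)
    (x : 'rV[R]_n) (l : 'I_n) :
  (x *m transvection i j c) 0 l = x 0 l + (if l == j then c * x 0 i else 0).
Proof.
rewrite mulmxDr mulmx1 -scalemxAr !mxE; congr (_ + _).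
rewrite (bigD1 i)//= big1 => [|k ki]; last by rewrite mxE (negPf ki) mulr0.
rewrite !mxE eqxx /= addr0.
by case: eqP => _; rewrite ?mulr1// !mulr0.
Qed.

Lemma det_transvection {R : realType} {n : nat} (i j : 'I_n) (c : R) :
  i != j -> \det (transvection i j c) = 1.
Proof.
have lower (k l : 'I_n) : (l < k)%N -> \det (transvection k l c) = 1.
  move=> lk; rewrite det_trig; last first.
    apply/is_trig_mxP => a b ab; rewrite !mxE.
    have -> : (a == b) = false by apply/eqP => ab'; rewrite ab' ltnn in ab.
    have -> : (a == k) && (b == l) = false.
      by apply/negP => /andP[/eqP al /eqP bl]; move: ab; rewrite al bl ltnNge ltnW.
    by rewrite mulr0 addr0.
  apply: big1 => a _; rewrite !mxE eqxx.
  have -> : (a == k) && (a == l) = false.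
    by apply/negP => /andP[/eqP -> /eqP kl]; move: lk; rewrite kl ltnn.
  by rewrite mulr0 addr0.
rewrite neq_ltn => /orP[ij|ji]; last exact: lower.
rewrite -det_tr -(lower _ _ ij); congr (\det _).
by apply/matrixP => a b; rewrite !mxE eq_sym andbC.
Qed.

Lemma transvection_mulN {R : realType} {n : nat} (i j : 'I_n) (c : R) :
  i != j -> transvection i j c *m transvection i j (- c) = 1%:M.
Proof.
move=> ij; rewrite /transvection mulmxDl mul1mx mulmxDr mulmx1.
rewrite -scalemxAl -scalemxAr mul_delta_mx_0 1?eq_sym// !scaler0 addr0.
by rewrite scaleNr subrK.
Qed.

Lemma exists_slice {R : realType} (a h x : R) (N : nat) :
  a <= x <= a + h * N.+1%:R ->
  exists2 t, (t < N.+1)%N & a + h * t%:R <= x <= a + h * t.+1%:R.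
Proof.
elim: N => [|N IH] /andP[ax xN]; first by exists 0%N; rewrite // mulr0 addr0 ax.
case: (lerP x (a + h * N.+1%:R)) => [xN'|Nx].
  by case: IH => [|t tN xt]; rewrite ?ax//; exists t => //; exact: ltnW.
by exists N.+1; rewrite // (ltW Nx).
Qed.

(** Cut the box into [N.+1] slices across the [i]-th axis: the image of a slice
    lies in a box that exceeds it along the [j]-th axis by [O(1/N)] only. *)
Lemma transvection_box_slices {R : realType} {n : nat} (i j : 'I_n) (c : R)
    (a b : 'rV[R]_n) (N : nat) (K : R) :
  i != j -> (forall l, a 0 l <= b 0 l) ->
  K = 2 * `|c| * (b 0 i - a 0 i) ^+ 2
      * \prod_(l | (l != i) && (l != j)) (b 0 l - a 0 l) ->
  (lebesgue_vol (mulmx^~ (transvection i j c) @` box a b)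
    <= (box_vol a b + K / N.+1%:R)%:E)%E.
Proof.
move=> ij ab defK; have n0 : (0 < n)%N by exact: leq_ltn_trans (leq0n i) (ltn_ord i).
pose h := (b 0 i - a 0 i) / N.+1%:R.
have N0 : N.+1%:R != 0 :> R by rewrite pnatr_eq0.
have h0 : 0 <= h by rewrite divr_ge0// subr_ge0.
pose s (t : nat) := a 0 i + h * t%:R.
pose u t : 'rV[R]_n := \row_l (if l == i then s t else
  if l == j then a 0 j + c * s t - `|c| * h else a 0 l).
pose v t : 'rV[R]_n := \row_l (if l == i then s t.+1 else
  if l == j then b 0 j + c * s t + `|c| * h else b 0 l).
have sS t : s t.+1 = s t + h by rewrite /s -natr1; ring.
have ch0 : 0 <= `|c| * h by rewrite mulr_ge0.
have uv t l : u t 0 l <= v t 0 l.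
  rewrite !mxE; case: eqP => _; first by rewrite sS lerDl.
  by case: eqP => // _; have := ab j; lra.
have volt t : box_vol (u t) (v t) = box_vol a b / N.+1%:R + K / N.+1%:R ^+ 2.
  have split2 (F : 'I_n -> R) :
      \prod_l F l = F i * (F j * \prod_(l | (l != i) && (l != j)) F l).
    by rewrite (bigD1 i)//= (bigD1 j)//= eq_sym.
  rewrite /box_vol !split2 !mxE !eqxx eq_sym (negPf ij).
  rewrite (eq_bigr (fun l => b 0 l - a 0 l)) => [|l /andP[/negPf li /negPf lj]]; last first.
    by rewrite !mxE li lj.
  rewrite defK sS /h; set P := \prod_(l | _) _.
  by field.
apply: (@le_trans _ _ (lebesgue_vol (\bigcup_(t in [set t | (t < N.+1)%N]) box (u t) (v t)))).
  apply: le_lebesgue_vol => _ [x xab <-].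
  have [t tN xt] : exists2 t, (t < N.+1)%N & s t <= x 0 i <= s t.+1.
    apply: exists_slice; rewrite /h mulrVK ?unitfE//.
    by have := xab i; rewrite [a 0 i + _]addrC subrK.
  exists t => // l; rewrite mulmx_transvection !mxE.
  case: eqP => [->|li]; first by rewrite (negPf ij) addr0.
  case: eqP => [->|lj]; last by rewrite addr0.
  have /andP[aj jb] := xab j.
  have : `|c * x 0 i - c * s t| <= `|c| * h.
    rewrite -mulrBr normrM ler_wpM2l// ger0_norm; first by move: xt; rewrite sS; lra.
    by move: xt; lra.
  by rewrite ler_norml; lra.
apply: le_trans (lebesgue_vol_bigcup_ord _ _ n0) _.
apply: (@le_trans _ _ (\sum_(t < N.+1) (box_vol a b / N.+1%:R + K / N.+1%:R ^+ 2)%:E)%E).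
  by apply: lee_sum => t _; rewrite -(volt t); exact: lebesgue_vol_box_le.
rewrite sumEFin sumr_const card_ord lee_fin -mulr_natr.
by rewrite le_eqVlt; apply/orP; left; apply/eqP; field.
Qed.

Lemma scales_vol_transvection {R : realType} {n : nat} (i j : 'I_n) (c : R) :
  i != j -> scales_vol (transvection i j c).
Proof.
move=> ij.
have le (c' : R) (S : set 'rV[R]_n) :
    (lebesgue_vol (mulmx^~ (transvection i j c') @` S)
      <= `|\det (transvection i j c')|%:E * lebesgue_vol S)%E.
  rewrite det_transvection// normr1.
  apply: lebesgue_vol_image_le => // {S}a b ab; rewrite mul1r.
  apply/lee_addgt0Pr => e e0.
  pose K := 2 * `|c'| * (b 0 i - a 0 i) ^+ 2
           * \prod_(l | (l != i) && (l != j)) (b 0 l - a 0 l).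
  apply: le_trans (transvection_box_slices i j c' a b (Num.truncn (K / e)) K ij ab erefl) _.
  rewrite -EFinD lee_fin lerD2l ler_pdivrMr// mulrC -ler_pdivrMr//.
  by apply/ltW/truncnS_gt.
apply: scales_vol_le (transvection_mulN i j c ij) _ _; exact: le.
Qed.

Lemma scales_vol1 {R : realType} {n : nat} : scales_vol (1%:M : 'M[R]_n).
Proof. by move=> S; rewrite image_mulmx1 det1 normr1 mul1e. Qed.

(** Left multiplication by this matrix adds to every row [i] the multiple
    [u i 0] of row [r]. *)
Definition add_row_mx {R : realType} {n : nat} (r : 'I_n) (u : 'cV[R]_n) : 'M[R]_n :=
  1%:M + u *m delta_mx 0 r.

Lemma add_row_mxE {R : realType} {n : nat} (r : 'I_n) (u : 'cV[R]_n)
    (L : 'M[R]_n) (i j : 'I_n) :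
  (add_row_mx r u *m L) i j = L i j + u i 0 * L r j.
Proof. by rewrite mulmxDl mul1mx -mulmxA -rowE !mxE big_ord1 mxE. Qed.

Lemma scales_vol_add_row {R : realType} {n : nat} (r : 'I_n) (u : 'cV[R]_n) :
  u r 0 = 0 -> add_row_mx r u \in unitmx /\ scales_vol (add_row_mx r u).
Proof.
move=> ur0; rewrite [u]matrix_sum_delta exchange_big big_ord1 /=.
pose K (v : 'cV[R]_n) :=
  [/\ v r 0 = 0, add_row_mx r v \in unitmx & scales_vol (add_row_mx r v)].
suff [] : K (\sum_i u i 0 *: delta_mx i 0) by [].
have K0 : K 0.
  by rewrite /K mxE /add_row_mx mul0mx addr0 unitmx1; split => //; exact: scales_vol1.
apply: (big_ind K) => // [v w [vr uv sv] [wr uw sw]|i _].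
  have e : add_row_mx r (v + w) = add_row_mx r v *m add_row_mx r w.
    rewrite /add_row_mx mulmxDr mulmx1 [in RHS]mulmxDl mul1mx mulmxDl -addrA.
    congr (_ + _); congr (_ + _).
    rewrite -[v *m _ *m _]mulmxA [delta_mx 0 r *m (w *m _)]mulmxA -rowE.
    have -> : row r w = 0 by apply/matrixP => a b; rewrite !mxE !ord1.
    by rewrite mul0mx mulmx0 addr0.
  split; first by rewrite mxE vr wr addr0.
    by rewrite e unitmx_mul uv uw.
  by rewrite e; exact: scales_vol_mul.
have [->|ir] := eqVneq i r; first by rewrite ur0 scale0r.
have e : add_row_mx r (u i 0 *: delta_mx i 0) = transvection i r (u i 0).
  by rewrite /add_row_mx -scalemxAl mul_delta_mx.
split; first by rewrite !mxE eq_sym (negPf ir) mulr0.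
  by rewrite e unitmxE det_transvection ?unitr1.
by rewrite e; exact: scales_vol_transvection.
Qed.

Lemma unitmx_col_neq0 {R : realType} {n : nat} (L : 'M[R]_n) (v : 'cV[R]_n) :
  L \in unitmx -> L *m v = 0 -> v = 0.
Proof. by move=> uL Lv; rewrite -[v]mul1mx -(mulVmx uL) -mulmxA Lv mulmx0. Qed.

(** If the columns before [r] are zero off the diagonal and no pivot were
    available, column [r] would be a combination of these columns. *)
Lemma exists_pivot {R : realType} {n : nat} (L : 'M[R]_n) (r : 'I_n) :
  L \in unitmx -> (forall i j : 'I_n, (j < r)%N -> i != j -> L i j = 0) ->
  exists2 i : 'I_n, (r <= i)%N & L i r != 0.
Proof.
move=> uL Ldiag; apply: contrapT => nopivot.
have Lr (i : 'I_n) : (r <= i)%N -> L i r = 0.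
  by move=> ri; apply/eqP/negPn/negP => Lir; apply: nopivot; exists i.
have Ljj (j : 'I_n) : (j < r)%N -> L j j != 0.
  move=> jr; apply/eqP => Ljj0.
  have /(unitmx_col_neq0 _ _ uL) : L *m delta_mx j 0 = 0 :> 'cV_n.
    rewrite -colE; apply/matrixP => a b; rewrite !mxE.
    by have [->//|aj] := eqVneq a j; exact: Ldiag.
  by move/matrixP/(_ j 0); rewrite !mxE !eqxx => /eqP; rewrite oner_eq0.
pose v : 'cV[R]_n := \col_j (if j == r then 1 else
  if (j < r)%N then - L j r / L j j else 0).
have /(unitmx_col_neq0 _ _ uL) : L *m v = 0.
  apply/matrixP => i z; rewrite [RHS]mxE mxE (bigD1 r)//= mxE eqxx mulr1.
  have vi (j : 'I_n) : j != r -> j != i -> L i j * v j z = 0.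
    move=> jr ji; rewrite mxE (negPf jr).
    by case: ifP => [jr'|_]; [rewrite Ldiag ?mul0r// eq_sym|rewrite mulr0].
  have [ri|ir] := leqP r i.
    rewrite Lr// add0r; apply: big1 => j jr.
    have [->|] := eqVneq j i; last exact: vi.
    rewrite mxE; case: eqP => [ir|_]; last by rewrite ltnNge ri mulr0.
    by rewrite ir Lr// mul0r.
  have irN : i != r by apply/eqP => e; rewrite e ltnn in ir.
  rewrite (bigD1 i)//= big1 ?addr0 => [|j /andP[]]; last exact: vi.
  rewrite mxE (negPf irN) ir mulrC divfK ?Ljj//; ring.
by move/matrixP/(_ r 0); rewrite !mxE eqxx => /eqP; rewrite oner_eq0.
Qed.

Lemma scales_vol_unitmx {R : realType} {n : nat} (L : 'M[R]_n) :
  L \in unitmx -> scales_vol L.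
Proof.
case: n L => [|n] L uL.
  by move: uL; rewrite flatmx0 => _; rewrite -(flatmx0 1%:M); exact: scales_vol1.
(* Gauss-Jordan elimination: all columns but the last d are already zero off the
   diagonal. *)
suff elim_cols d : forall L : 'M[R]_n.+1, L \in unitmx ->
    (forall i j : 'I_n.+1, (j < n.+1 - d)%N -> i != j -> L i j = 0) ->
    scales_vol L.
  by apply: (elim_cols n.+1 L uL) => i j; rewrite subnn.
elim: d => {L uL}[|d IH] L uL Ldiag.
  have defL : L = diag_mx (\row_j L j j).
    apply/matrixP => i j; rewrite !mxE.
    by have [->|ij] := eqVneq i j; rewrite ?mulr1n// mulr0n Ldiag// subn0.
  rewrite defL; apply: scales_vol_diag => // j.
  move: uL; rewrite {1}defL unitmxE det_diag unitfE => /prodf_neq0 /(_ j isT).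
  by rewrite !mxE.
have [nd|dn] := leqP n.+1 d.
  by apply: IH => // i j; rewrite (eqP nd).
pose r : 'I_n.+1 := inord (n.+1 - d.+1).
have rE : r = (n.+1 - d.+1)%N :> nat by rewrite inordK// subSS ltnS leq_subr.
have rS : (n.+1 - d)%N = r.+1 by rewrite rE subnSK.
rewrite -rE in Ldiag; rewrite rS in IH.
(* Column r is cleared with the pivot (r, r); the columns before r have a zero
   in row r and do not change. *)
have reduce (L' : 'M[R]_n.+1) : L' \in unitmx -> L' r r != 0 ->
    (forall i j : 'I_n.+1, (j < r)%N -> i != j -> L' i j = 0) -> scales_vol L'.
  move=> uL' L'rr L'diag.
  pose u : 'cV[R]_n.+1 := \col_i (if i == r then 0 else - L' i r / L' r r).
  have [uC sC] := scales_vol_add_row r u (ltac:(by rewrite mxE eqxx)).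
  apply: (scales_vol_cancel _ _ uC sC); apply: IH.
    by rewrite unitmx_mul uC.
  move=> i j; rewrite ltnS leq_eqVlt => /orP[/eqP/val_inj ->|jr] ij.
    by rewrite add_row_mxE mxE (negPf ij) divfK// addrN.
  rewrite add_row_mxE L'diag// L'diag ?mulr0 ?addr0//.
  by apply/eqP => e; rewrite e ltnn in jr.
have [i ri Lir] := exists_pivot L r uL Ldiag.
(* If the entry (r, r) vanishes, first add row i to row r. *)
have [Lrr|] := eqVneq (L r r) 0; last by move=> ?; exact: reduce.
have ir : i != r by apply: contraNneq Lir => ->; rewrite Lrr.
rewrite eq_sym in ir.
have uT : transvection r i (1 : R) \in unitmx.
  by rewrite unitmxE det_transvection ?unitr1.
have TE a b : (transvection r i 1 *m L) a b = L a b + (if a == r then L i b else 0).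
  rewrite mulmxDl mul1mx scale1r mxE; congr (_ + _).
  rewrite mxE (bigD1 i)//= big1 => [|k ki]; last by rewrite mxE (negPf ki) andbF mul0r.
  by rewrite mxE eqxx andbT addr0; case: eqP; rewrite ?mul1r// mul0r.
apply: (scales_vol_cancel _ _ uT (scales_vol_transvection _ _ _ ir)).
apply: reduce; first by rewrite unitmx_mul uT.
  by rewrite TE eqxx Lrr add0r.
move=> a b br ab; rewrite TE Ldiag// add0r; case: eqP => // _.
by rewrite Ldiag//; apply/eqP => e; rewrite -e ltnNge ri in br.
Qed.

(** * The volume of a box *)

Lemma lebesgue_measure_segment {R : realType} (u v : R) :
  u <= v -> (@lebesgue_measure R `[u, v]%classic = (v - u)%:E)%E.
Proof.
move=> uv; rewrite lebesgue_measure_itv/= lte_fin -EFinB; case: ltP => // vu.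
by rewrite (_ : v = u) ?subrr//; apply/eqP; rewrite eq_le vu.
Qed.

(** Slicing along the first axis: for [x] between [a 0 0] and [b 0 0] the slice
    at [x] is covered by the slices of those boxes whose first side contains
    [x]; integrating the inequality given by the induction hypothesis over [x]
    yields the next dimension.  The predicate [P] keeps the induction hypothesis
    applicable to this subfamily, including in dimension 0. *)
Lemma box_vol_le_cover {R : realType} {n : nat} (a b : 'rV[R]_n)
    (u v : nat -> 'rV[R]_n) (P : pred nat) :
  (forall j, a 0 j <= b 0 j) -> (forall l j, u l 0 j <= v l 0 j) ->
  box a b `<=` \bigcup_(l in [set l | P l]) box (u l) (v l) ->
  ((box_vol a b)%:E <= \sum_(0 <= l <oo | P l) (box_vol (u l) (v l))%:E)%E.
Proof.
elim: n a b u v P => [|n IH] a b u v P ab uv cover.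
  have [l /= Pl _] : (\bigcup_(l in [set l | P l]) box (u l) (v l)) a.
    by apply: cover => -[].
  apply: le_trans (nneseries_lim_ge l.+1 _); last first.
    by move=> i _ _; rewrite lee_fin box_vol_ge0.
  rewrite big_mkcond big_nat_recr//= Pl /box_vol !big_ord0.
  rewrite -[leLHS]add0e leeD2r//; apply: sume_ge0 => i _.
  by case: ifP; rewrite ?lee_fin// big_ord0.
pose tl (w : 'rV[R]_n.+1) : 'rV[R]_n := \row_j w 0 (lift ord0 j).
have volS (w z : 'rV[R]_n.+1) :
    box_vol w z = (z 0 ord0 - w 0 ord0) * box_vol (tl w) (tl z).
  rewrite /box_vol big_ord_recl; congr (_ * _).
  by apply: eq_bigr => j _; rewrite !mxE.
have tl_ge0 (w z : 'rV[R]_n.+1) : (forall j, w 0 j <= z 0 j) ->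
    0 <= box_vol (tl w) (tl z).
  by move=> wz; apply: box_vol_ge0 => j; rewrite !mxE.
pose D : set (measurableTypeR R) := `[a 0 ord0, b 0 ord0]%classic.
pose I l : set (measurableTypeR R) := `[u l 0 ord0, v l 0 ord0]%classic.
pose t l := if P l then box_vol (tl (u l)) (tl (v l)) else 0.
have t0 l : 0 <= t l by rewrite /t; case: ifP => // _; exact: tl_ge0.
pose f l (x : measurableTypeR R) : \bar R := ((t l)%:E * (\1_(I l) x)%:E)%E.
have f0 l x : (0 <= f l x)%E by rewrite mule_ge0 ?lee_fin.
have mf l : measurable_fun D (f l).
  apply: measurable_funTS; apply: measurable_funeM.
  by apply/measurable_EFinP; apply: measurable_indic; exact: measurable_itv.
have slice x : D x ->
    ((box_vol (tl a) (tl b))%:E <= \sum_(0 <= l <oo) f l x)%E.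
  rewrite /D /= in_itv /= => axb.
  apply: (@le_trans _ _ (\sum_(0 <= l <oo | P l && ((u l 0 ord0 <= (x : R) <= v l 0 ord0)%R))
      (box_vol (tl (u l)) (tl (v l)))%:E)%E).
    apply: (IH _ _ (fun l => tl (u l)) (fun l => tl (v l))).
    - by move=> j; rewrite !mxE.
    - by move=> l j; rewrite !mxE.
    move=> y yab; pose z : 'rV[R]_n.+1 :=
      \row_j (if unlift ord0 j is Some k then y 0 k else x).
    have /cover[l /= Pl zl] : box a b z.
      move=> j; rewrite mxE; case: unliftP => [k ->|->//].
      by have := yab k; rewrite !mxE.
    exists l => /=; first by rewrite Pl; have := zl ord0; rewrite mxE unlift_none.
    by move=> j; have := zl (lift ord0 j); rewrite !mxE liftK.
  rewrite eseries_mkcond; apply: lee_nneseries => [l _ _|l _].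
    by case: ifP => // _; rewrite lee_fin tl_ge0.
  rewrite /f /t indicE; case: (P l) => /=; last by rewrite mul0e.
  case: ifP => xl; last by rewrite mule_ge0 ?lee_fin ?tl_ge0.
  by rewrite mem_set ?mule1// /I /= in_itv.
have muD : lebesgue_measure D = (b 0 ord0 - a 0 ord0)%:E.
  exact: lebesgue_measure_segment.
have muI l : lebesgue_measure (I l) = (v l 0 ord0 - u l 0 ord0)%:E.
  exact: lebesgue_measure_segment.
have mI l : measurable (I l) by exact: measurable_itv.
have mD : measurable D by exact: measurable_itv.
have tlab := tl_ge0 _ _ ab.
have -> : (box_vol a b)%:E =
    (\int[lebesgue_measure]_(x in D) (cst (box_vol (tl a) (tl b))%:E) x)%E.
  by rewrite integral_cst//= muD volS mulrC EFinM.
apply: (@le_trans _ _ (\int[lebesgue_measure]_(x in D) \sum_(0 <= l <oo) f l x)%E).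
  apply: ge0_le_integral => //.
  by apply: (@ge0_emeasurable_sum _ _ _ D f xpredT).
rewrite integral_nneseries//.
rewrite [leRHS]eseries_mkcond; apply: lee_nneseries => [l _ _|l _].
  exact: integral_ge0.
rewrite ge0_integralZl_EFin//; last first.
  apply: measurable_funTS; apply/measurable_EFinP.
  by apply: measurable_indic; exact: measurable_itv.
rewrite integral_indic//=.
apply: (@le_trans _ _ ((t l)%:E * lebesgue_measure (I l))%E).
  by rewrite lee_wpmul2l ?lee_fin// le_measure ?inE//=; exact: measurableI.
rewrite muI -EFinM /t; case: ifP => _; last by rewrite mul0r.
by rewrite volS mulrC.
Qed.

Lemma lebesgue_vol_box_ge {R : realType} {n : nat} (a b : 'rV[R]_n) :
  (forall j, a 0 j <= b 0 j) -> ((box_vol a b)%:E <= lebesgue_vol (box a b))%E.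
Proof.
move=> ab; apply: le_ereal_inf_tmp => _ [u [v [uv cover ->]]].
apply: (box_vol_le_cover a b u v xpredT) => // x /cover[l _ xl].
by exists l.
Qed.

(** * The volume of a simplex *)

(** The convex hull of the origin and the standard basis vectors. *)
Definition std_simplex (R : realType) (n : nat) : set 'rV[R]_n :=
  [set x | (forall j, 0 <= x 0 j) /\ \sum_j x 0 j <= 1].

Lemma lebesgue_vol_std_simplex (R : realType) (n : nat) : (0 < n)%N ->
  (0 < lebesgue_vol (std_simplex R n) < +oo)%E.
Proof.
move=> n0; have n0R : 0 < n%:R :> R by rewrite ltr0n.
apply/andP; split.
  apply: (@lt_le_trans _ _ (lebesgue_vol (box 0 (const_mx n%:R^-1 : 'rV[R]_n)))).
    apply: lt_le_trans (lebesgue_vol_box_ge _ _ _); last first.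
      by move=> j; rewrite !mxE invr_ge0 ltW.
    by rewrite lte_fin /box_vol prodr_gt0// => j _; rewrite !mxE subr0 invr_gt0.
  apply: le_lebesgue_vol => x xb; split => [j|].
    by have /andP[+ _] := xb j; rewrite mxE.
  apply: (@le_trans _ _ (\sum_(j < n) n%:R^-1)).
    by apply: ler_sum => j _; have /andP[_] := xb j; rewrite mxE.
  by rewrite sumr_const card_ord -[_ *+ n]mulr_natr mulVf// gt_eqF.
apply: (@le_lt_trans _ _ (lebesgue_vol (box 0 (const_mx 1 : 'rV[R]_n)))).
  apply: le_lebesgue_vol => x [x0 x1] j; rewrite !mxE x0/=.
  by apply: le_trans x1; rewrite (bigD1 j)//= lerDl sumr_ge0.
apply: le_lt_trans (lebesgue_vol_box_le _ _ n0 _) _; last exact: ltry.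
by move=> j; rewrite !mxE.
Qed.

(** The edge vectors issuing from the first vertex. *)
Definition edge_mx {R : realType} {n : nat} (B : 'I_n.+1 -> 'rV[R]_n) : 'M[R]_n :=
  \matrix_i (B (lift ord0 i) - B ord0).

Lemma mulmx_edge {R : realType} {n : nat} (B : 'I_n.+1 -> 'rV[R]_n)
    (lam : 'I_n.+1 -> R) : \sum_i lam i = 1 ->
  \sum_i lam i *: B i = (\row_j lam (lift ord0 j)) *m edge_mx B + B ord0.
Proof.
move=> lam1; rewrite mulmx_sum_row big_ord_recl.
under [in RHS]eq_bigr => j _ do rewrite rowK mxE scalerBr.
rewrite sumrB -scaler_suml addrAC -addrA addrC; congr (_ + _).
move: lam1; rewrite big_ord_recl => /(canRL (addrK _)) ->.
by rewrite scalerBl scale1r.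
Qed.

Lemma simplex_image {R : realType} {n : nat} (B : 'I_n.+1 -> 'rV[R]_n) :
  simplex B = (fun x => x + B ord0) @` (mulmx^~ (edge_mx B) @` std_simplex R n).
Proof.
apply/seteqP; split => [P [lam lam0 [lam1 ->]]|_ [_ [x [x0 x1] <-] <-]].
  rewrite mulmx_edge//; exists ((\row_j lam (lift ord0 j)) *m edge_mx B) => //.
  exists (\row_j lam (lift ord0 j)) => //; split=> [j|]; first by rewrite mxE.
  under eq_bigr => j _ do rewrite mxE.
  by rewrite -lam1 [leRHS]big_ord_recl lerDr.
pose lam (i : 'I_n.+1) :=
  if unlift ord0 i is Some j then x 0 j else 1 - \sum_j x 0 j.
have lamS j : lam (lift ord0 j) = x 0 j by rewrite /lam liftK.
have lam1 : \sum_i lam i = 1.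
  rewrite big_ord_recl (eq_bigr _ (fun j _ => lamS j)).
  by rewrite /lam unlift_none subrK.
exists lam; first by move=> i; rewrite /lam; case: unliftP; rewrite ?subr_ge0.
split=> //; rewrite mulmx_edge//; congr (_ *m _ + _).
by apply/rowP => j; rewrite mxE lamS.
Qed.

Lemma simplex_volE {R : realType} {n : nat} (B : 'I_n.+1 -> 'rV[R]_n) :
  (0 < n)%N -> edge_mx B \in unitmx ->
  simplex_vol B = `|\det (edge_mx B)| * fine (lebesgue_vol (std_simplex R n)).
Proof.
move=> n0 uB; rewrite /simplex_vol simplex_image lebesgue_vol_translate//.
rewrite scales_vol_unitmx// fineM//.
have /andP[v0 voo] := lebesgue_vol_std_simplex R n n0.
by rewrite ge0_fin_numE ?lebesgue_vol_ge0.
Qed.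

Lemma affinely_independent_unitmx {R : realType} {n : nat}
    (A : 'I_n.+1 -> 'rV[R]_n) :
  affinely_independent A -> edge_mx A \in unitmx.
Proof.
move=> indA; rewrite -row_free_unit; apply: inj_row_free => v vA.
pose c (i : 'I_n.+1) :=
  if unlift ord0 i is Some j then v 0 j else - \sum_j v 0 j.
have c0 : c ord0 = - \sum_j v 0 j by rewrite /c unlift_none.
have cS j : c (lift ord0 j) = v 0 j by rewrite /c liftK.
apply/rowP => j; rewrite -cS mxE; apply: indA.
  by rewrite big_ord_recl (eq_bigr _ (fun k _ => cS k)) c0 addNr.
rewrite big_ord_recl; under eq_bigr => k _ do rewrite cS.
rewrite c0.
rewrite -[RHS]vA mulmx_sum_row.
under [in RHS]eq_bigr => k _ do rewrite rowK scalerBr.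
by rewrite sumrB -scaler_suml scaleNr addrC.
Qed.

(** Row [i] is the point [B i] in homogeneous coordinates, [(1, B i)]. *)
Definition homog_mx {R : realType} {n : nat} (B : 'I_n.+1 -> 'rV[R]_n) : 'M[R]_(1 + n) :=
  \matrix_(i < 1 + n) row_mx (1%:M : 'M[R]_1) (B i).

Lemma det_homog_mx {R : realType} {n : nat} (B : 'I_n.+1 -> 'rV[R]_n) :
  \det (homog_mx B) = \det (edge_mx B).
Proof.
pose L : 'M[R]_(1 + n) := block_mx 1%:M 0 (const_mx (-1)) 1%:M.
have L1 : \det L = 1 by rewrite det_lblock !det1 mulr1.
have homogE : homog_mx B = block_mx 1%:M (B ord0) (const_mx 1)
    (\matrix_i B (lift ord0 i)).
  rewrite [LHS]/homog_mx; apply/matrixP => i j; rewrite mxE.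
  case: (split_ordP i) => k ->; case: (split_ordP j) => l ->.
  - by rewrite row_mxEl block_mxEul !ord1.
  - rewrite row_mxEr block_mxEur !ord1; congr (B _ _ _); exact: val_inj.
  - by rewrite row_mxEl block_mxEdl !ord1 !mxE.
  - by rewrite row_mxEr block_mxEdr !mxE rshift1.
have -> : \det (edge_mx B) = \det (L *m homog_mx B).
  rewrite homogE mulmx_block !mul1mx !mul0mx !addr0.
  have -> : const_mx (-1) *m 1%:M + const_mx 1 = 0 :> 'M[R]_(n, 1).
    by rewrite mulmx1; apply/matrixP => i j; rewrite !mxE addNr.
  rewrite det_ublock det1 mul1r; congr (\det _).
  by apply/matrixP => i j; rewrite !mxE big_ord1 !mxE mulN1r addrC.
by rewrite det_mulmx L1 mul1r.
Qed.

Lemma simplex_vol_ratio {R : realType} {n : nat} (A B : 'I_n.+1 -> 'rV[R]_n)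
    (C : 'M[R]_n.+1) :
  (0 < n)%N -> affinely_independent A -> \det C != 0 ->
  (forall i, barycentric A (C i) (B i)) ->
  simplex_vol B / simplex_vol A = `|\det C|.
Proof.
move=> n0 /affinely_independent_unitmx uA dC AB.
have BE : homog_mx B = C *m homog_mx A.
  apply/row_matrixP => i; rewrite row_mul mulmx_sum_row rowK.
  have [C1 ->] := AB i.
  under [in RHS]eq_bigr => j _ do rewrite rowK scale_row_mx mxE.
  have -> : \sum_(j < 1 + n) row_mx (C i j *: 1%:M) (C i j *: A j) =
      row_mx (\sum_j C i j *: 1%:M) (\sum_j C i j *: A j) :> 'rV_(1 + n).
    apply/matrixP => a b; rewrite summxE ord1.
    case: (split_ordP b) => k ->.
      by rewrite row_mxEl summxE; apply: eq_bigr => j _; rewrite row_mxEl.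
    by rewrite row_mxEr summxE; apply: eq_bigr => j _; rewrite row_mxEr.
  by rewrite -scaler_suml C1 scale1r.
have dB : \det (edge_mx B) = \det C * \det (edge_mx A).
  by rewrite -!det_homog_mx BE det_mulmx.
have dA : \det (edge_mx A) != 0 by rewrite -unitfE -unitmxE.
have uB : edge_mx B \in unitmx by rewrite unitmxE unitfE dB mulf_neq0.
rewrite !simplex_volE// dB normrM -[_ * _ * fine _]mulrA mulfK//.
have /andP[v0 voo] := lebesgue_vol_std_simplex R n n0.
by rewrite mulf_neq0 ?normr_eq0// gt_eqF// fine_gt0 ?v0.
Qed.

(** * Barycentric coordinates of the feet *)

Lemma exists_ord_neq {n : nat} (i : 'I_n.+1) : (0 < n)%N -> exists j, j != i.
Proof.
move=> n0; have [->|i0] := eqVneq i ord0.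
  by exists ord_max; rewrite -val_eqE /= -lt0n.
by exists ord0; rewrite eq_sym.
Qed.

Lemma lt1_of_sum1 {R : realType} {n : nat} (x : 'I_n.+1 -> R) :
  (0 < n)%N -> (forall i, 0 < x i) -> \sum_i x i = 1 -> forall i, x i < 1.
Proof.
move=> n0 x0 sx i; have [j ji] := exists_ord_neq i n0.
rewrite -sx [ltRHS](bigD1 i)//= ltrDl (bigD1 j)//= ltr_wpDr//.
by rewrite sumr_ge0// => l _; exact: ltW.
Qed.

Lemma barycentric_unique {R : realType} {n p : nat} (A : 'I_p -> 'rV[R]_n)
    (c d : 'I_p -> R) (P : 'rV[R]_n) :
  affinely_independent A -> barycentric A c P -> barycentric A d P -> c =1 d.
Proof.
move=> indA [c1 cP] [d1 dP] i; apply/eqP; rewrite -subr_eq0; apply/eqP.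
apply: (indA (fun i => c i - d i)); first by rewrite sumrB c1 d1 subrr.
under eq_bigr => j _ do rewrite scalerBl.
by rewrite sumrB -cP -dP subrr.
Qed.

Lemma barycentric_vertex {R : realType} {n p : nat} (A : 'I_p -> 'rV[R]_n) (j : 'I_p) :
  barycentric A (fun i => (i == j)%:R) (A j).
Proof.
split; first by rewrite (bigD1 j)//= eqxx big1 ?addr0// => i /negPf ->.
by rewrite (bigD1 j)//= eqxx scale1r big1 ?addr0// => i /negPf ->; rewrite scale0r.
Qed.

Lemma barycentric_line {R : realType} {n p : nat} (A : 'I_p -> 'rV[R]_n)
    (c d : 'I_p -> R) (P Q : 'rV[R]_n) (s : R) :
  barycentric A c P -> barycentric A d Q ->
  barycentric A (fun i => (1 - s) * c i + s * d i) (P + s *: (Q - P)).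
Proof.
move=> [c1 ->] [d1 ->]; split.
  by rewrite big_split/= -!mulr_sumr c1 d1; ring.
under [RHS]eq_bigr => i _ do rewrite scalerDl -!scalerA.
rewrite big_split/= -!scaler_sumr scalerBl scale1r scalerBr.
by rewrite addrA addrAC.
Qed.

Lemma barycentric_interior {R : realType} {n : nat} (A : 'I_n.+1 -> 'rV[R]_n)
    (M : 'rV[R]_n) : (0 < n)%N -> affinely_independent A ->
  interior (simplex A) M ->
  exists2 lam : 'I_n.+1 -> R, (forall i, 0 < lam i) & barycentric A lam M.
Proof.
move=> n0 indA intM; have [lam lam0 lamM] := interior_subset intM.
exists lam => // i; rewrite lt_neqAle lam0 andbT eq_sym; apply/eqP => lami.
(* If coordinate i of M is 0, the points M + s (A_i - M) with s < 0 have a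
   negative coordinate i, although they lie in the simplex for small s. *)
have cvgM : M + s *: (A i - M) @[s --> (0 : R)] --> M.
  have : M + s *: (A i - M) @[s --> (0 : R)] --> M + 0 *: (A i - M).
    by apply: cvgD; [exact: cvg_cst|apply: cvgZr_tmp; exact: cvg_id].
  by rewrite scale0r addr0.
have : \forall s \near (0 : R)^'-, simplex A (M + s *: (A i - M)).
  by apply: cvg_within; exact: cvgM intM.
move=> nearA.
have [s [s0 [d d0 dP]]] : exists s : R, s < 0 /\ simplex A (M + s *: (A i - M)).
  near (0 : R)^'- => s; exists s; split; first by near: s; exact: nbhs_left_lt.
  by near: s.
have := barycentric_line A _ _ _ _ s lamM (barycentric_vertex A i).
move/(barycentric_unique _ _ _ _ indA dP)/(_ i).
by rewrite lami eqxx mulr0 add0r mulr1 => di; have := d0 i; rewrite di leNgt s0.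
Unshelve. all: by end_near. Qed.

Lemma barycentric_foot {R : realType} {n p : nat} (A : 'I_p -> 'rV[R]_n)
    (lam : 'I_p -> R) (M N : 'rV[R]_n) (j : 'I_p) :
  affinely_independent A -> barycentric A lam M -> lam j != 1 ->
  opposite_hyperplane A j N -> collinear (A j) M N ->
  barycentric A (fun i => if i == j then 0 else lam i / (1 - lam j)) N.
Proof.
move=> indA lamM lamj [d dj dN] [orig [u [a [b [c [Aj MO NO] ] ] ] ] ].
have ab : b - a != 0.
  rewrite subr_eq0; apply/eqP => ab; move/eqP: lamj; apply.
  have AM : A j = M by rewrite Aj MO ab.
  have := barycentric_vertex A j; rewrite AM.
  by move=> /(barycentric_unique _ _ _ _ indA lamM)/(_ j); rewrite eqxx.
pose s := (c - a) / (b - a).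
have NE : N = A j + s *: (M - A j).
  rewrite NO MO Aj opprD addrACA subrr add0r -scalerBl scalerA divfK//.
  by rewrite -addrA -scalerDl subrKC.
have NL : barycentric A (fun i => (1 - s) * (i == j)%:R + s * lam i) N.
  by rewrite NE; apply: barycentric_line => //; exact: barycentric_vertex.
have sE : s = (1 - lam j)^-1.
  have := barycentric_unique _ _ _ _ indA NL dN j; rewrite dj eqxx mulr1 => e.
  have l0 : 1 - lam j != 0 by rewrite subr_eq0 eq_sym.
  by apply: (mulIf l0); rewrite mulVf//; lra.
have E i : (1 - s) * (i == j)%:R + s * lam i = if i == j then 0 else lam i / (1 - lam j).
  have := barycentric_unique _ _ _ _ indA NL dN j; rewrite dj eqxx.
  by have [->|_ _] := eqVneq i j; last by rewrite mulr0n mulr0 add0r sE mulrC.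
case: NL => [N1 N2]; split; first by rewrite -[RHS]N1; apply: eq_bigr => i _; rewrite E.
by rewrite {1}N2; apply: eq_bigr => i _; rewrite E.
Qed.

Lemma det_row_diag {R : comNzRingType} {n : nat} (T : 'M[R]_n) (i : 'I_n) :
  (forall j, j != i -> T i j = 0) -> \det T = T i i * \det (row' i (col' i T)).
Proof.
move=> T0; rewrite (expand_det_row T i) (bigD1 i)//= big1 ?addr0 => [|j ji].
  by rewrite /cofactor addnn -signr_odd odd_double mul1r.
by rewrite T0 ?mul0r.
Qed.

(** The barycentric coordinates of the vertices of [cevian_subsimplex M N i]. *)
Definition cevian_mx {R : realType} {p : nat} (lam : 'I_p -> R) (i : 'I_p) : 'M[R]_p :=
  \matrix_(j, l) (if j == i then lam l else
                  if l == j then 0 else lam l / (1 - lam j)).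

(** Row [j != i] of [cevian_mx lam i] is
    [(lam - lam j *: e_j) / (1 - lam j)], where [lam] is row [i]; hence the
    factorization through the matrix [K] obtained from the identity by replacing
    row [i] with [lam]. *)
Lemma det_cevian_mx {R : realType} {p : nat} (lam : 'I_p -> R) (i : 'I_p) :
  (forall j, 0 < lam j) -> (forall j, lam j < 1) ->
  `|\det (cevian_mx lam i)| = (1 - lam i) * \prod_j (lam j / (1 - lam j)).
Proof.
move=> l0 l1; have nl j : 1 - lam j != 0 by rewrite gt_eqF// subr_gt0.
pose r j := lam j / (1 - lam j).
pose K : 'M[R]_p := \matrix_(j, l) (if j == i then lam l else (j == l)%:R).
pose T : 'M[R]_p := \matrix_(j, l) (if j == i then (l == i)%:R else
  - r j * (j == l)%:R + (l == i)%:R / (1 - lam j)).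
have -> : cevian_mx lam i = T *m K.
  apply/matrixP => j l; rewrite mxE [RHS]mxE (bigD1 i)//=.
  have [->|ji] := eqVneq j i.
    rewrite !mxE !eqxx mul1r big1 ?addr0// => k ki.
    by rewrite !mxE eqxx (negPf ki) mul0r.
  rewrite (bigD1 j)//= big1 ?addr0 => [|k /andP[ki kj]]; last first.
    by rewrite !mxE (negPf ji) (negPf ki) eq_sym (negPf kj) mulr0 mul0r addr0 mul0r.
  rewrite !mxE !eqxx (negPf ji) mulr0 mul0r add0r addr0 mulr1 eq_sym.
  by case: eqP => [->|_] /=; rewrite /r; field.
have detK : \det K = lam i.
  rewrite -det_tr (det_row_diag _ i) => [|j ji]; last first.
    by rewrite !mxE (negPf ji).
  rewrite !mxE eqxx (_ : row' i (col' i K^T) = 1%:M) ?det1 ?mulr1//.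
  by apply/matrixP => a b; rewrite !mxE eq_sym (negPf (neq_lift _ _)) (inj_eq lift_inj) eq_sym.
have detT : \det T = \prod_j - r (lift i j).
  rewrite (det_row_diag _ i) => [|j ji]; last by rewrite !mxE eqxx (negPf ji).
  have -> : row' i (col' i T) = diag_mx (\row_j - r (lift i j)).
    apply/matrixP => a b; rewrite !mxE ![lift i _ == i]eq_sym !(negPf (neq_lift _ _)).
    by rewrite (inj_eq lift_inj) mul0r addr0 mulr_natr.
  rewrite !mxE !eqxx mul1r det_diag.
  by apply: eq_bigr => j _; rewrite mxE.
rewrite det_mulmx detK detT normrM normr_prod gtr0_norm// (bigD1_ord i)//=.
rewrite (eq_bigr (fun j => r (lift i j))) => [|j _].
  by rewrite mulrC mulrA; congr (_ * _); rewrite [_ * (_ / _)]mulrC divfK.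
by rewrite normrN gtr0_norm// divr_gt0 ?subr_gt0.
Qed.

(** * Averaging the coordinates of a block *)

Lemma ln_le_subr1 {R : realType} (x : R) : 0 < x -> ln x <= x - 1.
Proof. by move=> x0; have := @le_ln1Dx R (x - 1); rewrite subrKC; apply; lra. Qed.

(** Jensen's inequality for the logarithm, the quotients [x i / w i] and the
    weights [w i]. *)
Lemma ln_sum_ge {R : realType} {I : finType} (P : pred I) (w x : I -> R) (W X : R) :
  0 < W -> 0 < X -> (forall i, P i -> 0 < w i) -> (forall i, P i -> 0 < x i) ->
  \sum_(i | P i) w i = W -> \sum_(i | P i) x i = X ->
  \sum_(i | P i) w i * (ln (x i) - ln (w i)) <= W * (ln X - ln W).
Proof.
move=> W0 X0 w0 x0 sw sx.
have le i : P i ->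
    w i * (ln (x i) - ln (w i)) <= W / X * x i - w i + w i * (ln X - ln W).
  move=> Pi; have wi := w0 i Pi; have xi := x0 i Pi.
  have q0 : 0 < (x i * W) / (w i * X) by rewrite divr_gt0 ?mulr_gt0.
  have := ln_le_subr1 _ q0; rewrite ln_div ?posrE ?mulr_gt0// !lnM ?posrE//.
  move=> h; have := ler_wpM2l (ltW wi) h.
  have -> : w i * (x i * W / (w i * X) - 1) = W / X * x i - w i.
    by field; rewrite !gt_eqF.
  by lra.
apply: le_trans (ler_sum _ le) _.
rewrite big_split/= sumrB -mulr_sumr -mulr_suml sw sx divfK ?gt_eqF//.
by lra.
Qed.

(** Replacing every coordinate in the block [P] by the mean [t] of the block does
    not decrease the product of the [x i / (1 - x i)] over the block.  For [i] in
    [P], Jensen's inequality compares [1 - x i], the sum of the other coordinates,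
    with [1 - t], the corresponding sum for the averaged point [w]. *)
Lemma sum_logit_le_mean {R : realType} {I : finType} (P : pred I) (x : I -> R)
    (t : R) :
  (0 < #|P|)%N -> (forall i, 0 < x i) -> (forall i, x i < 1) ->
  \sum_i x i = 1 -> \sum_(i | P i) x i = #|P|%:R * t -> t < 1 ->
  \sum_(i | P i) (ln (x i) - ln (1 - x i)) <= #|P|%:R * (ln t - ln (1 - t)).
Proof.
move=> P0 x0 x1 sx sP t1; set c := #|P|%:R in sP *.
have c0 : 0 < c by rewrite ltr0n.
have c1 : 1 <= c by rewrite ler1n.
have t0 : 0 < t.
  rewrite -(pmulr_rgt0 _ c0) -sP; case/card_gt0P: P0 => i Pi.
  by rewrite (bigD1 i)//= ltr_wpDr// sumr_ge0// => j _; exact: ltW.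
have ct1 : c * t <= 1.
  by rewrite -sP -sx [leRHS](bigID P)/= lerDl sumr_ge0// => j _; exact: ltW.
have cst : \sum_(i | P i) t = c * t by rewrite sumr_const mulr_natl.
pose w i := if P i then t else x i.
have w0 i : 0 < w i by rewrite /w; case: ifP.
have sw : \sum_i w i = 1.
  rewrite -sx (bigID P) [RHS](bigID P)/= sP -cst; congr (_ + _); apply: eq_bigr => i.
    by rewrite /w => ->.
  by rewrite /w => /negPf ->.
pose y i := ln (x i) - ln t.
pose Y := \sum_(i | P i) y i.
have ptw i : P i -> t * (Y - y i) <= (1 - t) * (ln (1 - x i) - ln (1 - t)).
  move=> Pi; have wi : w i = t by rewrite /w Pi.
  have := ln_sum_ge (fun j => j != i) w x (1 - t) (1 - x i).
  rewrite !subr_gt0 => /(_ t1 (x1 i) (fun j _ => w0 j) (fun j _ => x0 j)).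
  have -> : \sum_(j | j != i) w j = 1 - t.
    by rewrite -sw -wi [X in _ = X - _](bigD1 i)//= [RHS]addrC addKr.
  have -> : \sum_(j | j != i) x j = 1 - x i.
    by rewrite -sx [X in _ = X - _](bigD1 i)//= [RHS]addrC addKr.
  move=> /(_ erefl erefl); apply: le_trans.
  rewrite (bigID P)/= [X in _ <= _ + X]big1 ?addr0; last first.
    by move=> j /andP[_ /negPf Pj]; rewrite /w Pj subrr mulr0.
  rewrite {1}/Y (bigD1 i)//= [y i + _]addrC addrK mulr_sumr.
  rewrite le_eqVlt; apply/orP; left; apply/eqP.
  rewrite [RHS](eq_bigl (fun j => P j && (j != i))); last by move=> j; rewrite andbC.
  by apply: eq_bigr => j /andP[Pj _]; rewrite /w Pj.
have sY : \sum_(i | P i) y i = Y by [].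
have yE i : y i = ln (x i) - ln t by [].
clearbody Y y.
have := ler_sum (index_enum I) ptw.
rewrite -mulr_sumr -[leRHS]mulr_sumr => le.
rewrite !sumrB !sumr_const sY -[Y *+ _]mulr_natl -[ln (1 - t) *+ _]mulr_natl -/c in le.
rewrite sumrB.
have Y0 : Y <= 0.
  have : Y <= \sum_(i | P i) (x i / t - 1).
    rewrite -sY; apply: ler_sum => i _; rewrite yE -ln_div ?posrE//.
    by apply: ln_le_subr1; rewrite divr_gt0.
  by rewrite sumrB -mulr_suml sP sumr_const -/c mulfK ?gt_eqF// subrr.
have YE : Y = \sum_(i | P i) ln (x i) - c * ln t.
  by rewrite -sY (eq_bigr _ (fun i _ => yE i)) sumrB sumr_const mulr_natl.
move: le YE; set L := \sum_(i | P i) ln (1 - x i); set K := \sum_(i | P i) ln (x i).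
move=> le YE; have t1' : 0 < 1 - t by lra.
(* Summing over the block gives the factor (c - 1) t / (1 - t) <= 1 in front of
   Y <= 0. *)
have {}le : (1 - t) * Y <= (1 - t) * (L - c * ln (1 - t)).
  apply: le_trans le; rewrite -subr_ge0.
  have -> : t * (c * Y - Y) - (1 - t) * Y = (1 - c * t) * (- Y) by ring.
  by rewrite mulr_ge0; lra.
by move: le; rewrite ler_pM2l//; lra.
Qed.

Lemma card_ord_lt (n k : nat) : (k <= n)%N ->
  (#|[pred i : 'I_n | (i < k)%N]| = k) * (#|[pred i : 'I_n | ~~ (i < k)%N]| = n - k)%N.
Proof.
move=> kn; have cP : #|[pred i : 'I_n | (i < k)%N]| = k.
  by rewrite -sum1_card (big_ord_narrow kn) sum1_card card_ord.
split => //; apply: (@addnI k); rewrite subnKC//.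
have := cardC [pred i : 'I_n | (i < k)%N]; rewrite cP card_ord => e.
rewrite -[RHS]e; congr (_ + _)%N; apply: eq_card => i; rewrite !inE.
Qed.

Lemma ln_prod {R : realType} {I : finType} (x : I -> R) :
  (forall i, 0 < x i) -> ln (\prod_i x i) = \sum_i ln (x i).
Proof.
move=> x0; suff [] : 0 < \prod_i x i /\ ln (\prod_i x i) = \sum_i ln (x i) by [].
apply: (big_ind2 (fun (a b : R) => 0 < a /\ ln a = b)).
- by rewrite ltr01 ln1.
- by move=> a b c d [a0 <-] [c0 <-]; rewrite mulr_gt0// lnM.
- by move=> i _; split.
Qed.

(** * The cubic and the one-variable maximum *)

Lemma ln_sum_ge2 {R : realType} (a b x y x0 y0 : R) :
  0 < a -> 0 < b -> 0 < x -> 0 < y -> 0 < x0 -> 0 < y0 ->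
  a * x0 * (ln x - ln x0) + b * y0 * (ln y - ln y0)
    <= (a * x0 + b * y0) * (ln (a * x + b * y) - ln (a * x0 + b * y0)).
Proof.
move=> a0 b0 xp yp x0p y0p.
pose w (i : bool) := if i then a * x0 else b * y0.
pose z (i : bool) := if i then a * x else b * y.
have wp i : 0 < w i by rewrite /w; case: i; exact: mulr_gt0.
have zp i : 0 < z i by rewrite /z; case: i; exact: mulr_gt0.
have := @ln_sum_ge R bool xpredT w z (w true + w false) (z true + z false).
rewrite !big_bool => /(_ (addr_gt0 _ _) (addr_gt0 _ _)).
move=> /(_ (wp _) (wp _) (zp _) (zp _) (fun i _ => wp i) (fun i _ => zp i) erefl erefl).
rewrite /w /z !lnM ?posrE//.
by congr (_ * _ + _ * _ <= _); ring.
Qed.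

(** Up to a positive factor, this is the logarithmic derivative of [two_block]
    below. *)
Lemma q_factor {R : realType} (k m : nat) (x : R) : q k m x =
  (k%:R - x) * (1 - k%:R * x) * (m%:R - 1 + k%:R * x) - k%:R * m%:R ^+ 2 * x * (1 - x).
Proof. by rewrite /q; ring. Qed.

Lemma q0_gt0 {R : realType} (k m : nat) :
  (1 < k)%N -> (1 < m)%N -> 0 < q k m (0 : R).
Proof.
move=> k1 m1; rewrite q_factor.
have : (1 : R) < k%:R by rewrite ltr1n.
have : (1 : R) < m%:R by rewrite ltr1n.
by nra.
Qed.

Lemma q_invk_lt0 {R : realType} (k m : nat) :
  (1 < k)%N -> (1 < m)%N -> q k m (k%:R^-1 : R) < 0.
Proof.
move=> k1 m1; have k0 : (1 : R) < k%:R by rewrite ltr1n.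
have m0 : (0 : R) < m%:R by rewrite ltr0n ltnW.
rewrite q_factor mulfV ?subrr ?mulr0 ?mul0r ?sub0r; last by rewrite gt_eqF//; lra.
have -> : k%:R * m%:R ^+ 2 * k%:R^-1 * (1 - k%:R^-1) = m%:R ^+ 2 * (1 - k%:R^-1) :> R.
  by field; rewrite gt_eqF//; lra.
rewrite oppr_lt0 mulr_gt0 ?exprn_gt0// subr_gt0 invf_lt1//; lra.
Qed.

(** Given two zeros in the interval, the remaining linear factor [h] of [q] would
    be positive at [0] and negative at [1/k], although it increases. *)
Lemma q_zero_unique {R : realType} (k m : nat) : (1 < k)%N -> (1 < m)%N ->
  exists! theta : R, q_zero k m theta.
Proof.
move=> k1 m1; have k0 : (0 : R) < k%:R by rewrite ltr0n ltnW.
pose c : seq R := [:: k%:R * (m%:R - 1);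
  2 * k%:R ^+ 2 - k%:R ^+ 2 * m%:R - k%:R * m%:R ^+ 2 - m%:R + 1;
  - (k%:R * (k%:R ^+ 2 - m%:R ^+ 2 - m%:R + 2)); k%:R ^+ 2].
have polE (x : R) : (- Poly c).[x] = - q k m x.
  by rewrite hornerN horner_Poly /q /=; ring.
have q0 := @q0_gt0 R k m k1 m1; have qk := @q_invk_lt0 R k m k1 m1.
have [||theta /andP[t0 tk] /rootP] := @poly_ivt R (- Poly c) 0 k%:R^-1.
- by rewrite invr_ge0 ltW.
- by rewrite !polE oppr_le0 oppr_ge0 !ltW.
rewrite polE => /eqP; rewrite oppr_eq0 => /eqP qt.
have th : q_zero k m theta.
  split=> //; rewrite !lt_neqAle t0 tk !andbT; apply/andP; split.
    by apply/eqP => e; move: q0; rewrite [X in q k m X]e qt ltxx.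
  by apply/eqP => e; move: qk; rewrite -e qt ltxx.
exists theta; split => // theta' th'.
case: th th' => [/andP[t0' tk'] _] [/andP[s0 sk] qs].
apply/eqP/negPn/negP => ne.
pose s := theta'; rewrite -/s in s0 sk qs ne.
pose h (z : R) := k%:R ^+ 2 * (theta + s + z) - k%:R * (k%:R ^+ 2 - m%:R ^+ 2 - m%:R + 2).
have qh z : q k m z = (z - theta) * (z - s) * h z.
  have d0 : theta - s != 0 by rewrite subr_eq0.
  apply: (mulfI d0).
  have -> : (theta - s) * q k m z = (theta - s) * ((z - theta) * (z - s) * h z)
      + q k m theta * (z - s) - q k m s * (z - theta).
    by rewrite /h /q; ring.
  by rewrite qt qs !mul0r addr0 subr0.
have h0 : 0 < h 0.
  move: q0; rewrite qh !sub0r mulrNN pmulr_rgt0//; exact: mulr_gt0.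
have hk : h k%:R^-1 < 0.
  by move: qk; rewrite qh pmulr_rlt0// mulr_gt0 ?subr_gt0.
have : h 0 <= h k%:R^-1.
  rewrite /h lerD2r; apply: ler_wpM2l; first by rewrite exprn_ge0 ?ltW.
  by rewrite lerD2l invr_ge0 ltW.
by move/le_lt_trans/(_ hk)/(lt_trans h0); rewrite ltxx.
Qed.

(** The ratio of volumes at the point with [k] coordinates [t] and [m]
    coordinates [u = (1 - k * t) / m]. *)
Definition two_block {R : realType} (k m : nat) (t : R) : R :=
  let u := (1 - k%:R * t) / m%:R in
  k%:R * (1 - t) * (t / (1 - t)) ^+ k * (u / (1 - u)) ^+ m.

Lemma two_block_bounds {R : realType} (k m : nat) (t : R) :
  (1 < k)%N -> (1 < m)%N -> 0 < t < k%:R^-1 ->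
  [/\ t < 1, 0 < (1 - k%:R * t) / m%:R & (1 - k%:R * t) / m%:R < 1].
Proof.
move=> k1 m1 /andP[t0 tk].
have kR : (1 : R) < k%:R by rewrite ltr1n.
have mR : (1 : R) < m%:R by rewrite ltr1n.
have kt : k%:R * t < 1.
  by rewrite mulrC -ltr_pdivlMr ?mul1r//; lra.
split.
- by nra.
- by rewrite divr_gt0//; lra.
- by rewrite ltr_pdivrMr; nra.
Qed.

Lemma two_block_gt0 {R : realType} (k m : nat) (t : R) :
  (1 < k)%N -> (1 < m)%N -> 0 < t < k%:R^-1 ->
  0 < two_block k m t.
Proof.
move=> k1 m1 tk; have [t1 u0 u1] := two_block_bounds k m t k1 m1 tk.
have /andP[t0 _] := tk; have kR : (0 : R) < k%:R by rewrite ltr0n ltnW.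
move: u0 u1; rewrite /two_block; move: (_ / _) => u u0 u1.
by rewrite !mulr_gt0 ?exprn_gt0 ?divr_gt0 ?subr_gt0.
Qed.

Lemma ln_two_block {R : realType} (k m : nat) (t : R) :
  (1 < k)%N -> (1 < m)%N -> 0 < t < k%:R^-1 ->
  let u := (1 - k%:R * t) / m%:R in
  ln (two_block k m t) = ln k%:R + ln (1 - t) + k%:R * (ln t - ln (1 - t))
                         + m%:R * (ln u - ln (1 - u)).
Proof.
move=> k1 m1 tk u; have [t1 u0 u1] := two_block_bounds k m t k1 m1 tk.
have /andP[t0 _] := tk; rewrite -/u in u0 u1.
have t1' : 0 < 1 - t by rewrite subr_gt0.
have u1' : 0 < 1 - u by rewrite subr_gt0.
have k0 : (0 : R) < k%:R by rewrite ltr0n ltnW.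
have tq : 0 < t / (1 - t) by rewrite divr_gt0.
have uq : 0 < u / (1 - u) by rewrite divr_gt0.
rewrite /two_block -/u; clearbody u.
rewrite !lnM ?posrE ?mulr_gt0 ?exprn_gt0//.
by rewrite !lnXn// !ln_div ?posrE// -[(ln t - _) *+ _]mulr_natl -[(ln u - _) *+ _]mulr_natl.
Qed.

Lemma two_block_bound {R : realType} (k m : nat) (theta : R) :
  (1 < k)%N -> (1 < m)%N -> 0 < theta < k%:R^-1 ->
  two_block k m theta = bound k m theta.
Proof.
move=> k1 m1 tk; have [t1 u0 u1] := two_block_bounds k m theta k1 m1 tk.
have m0 : m%:R != 0 :> R by rewrite pnatr_eq0 -lt0n ltnW.
have t1' : 1 - theta != 0 by rewrite gt_eqF// subr_gt0.
have d0 : m%:R - 1 + k%:R * theta != 0.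
  have -> : m%:R - 1 + k%:R * theta = m%:R * (1 - (1 - k%:R * theta) / m%:R).
    by field.
  by rewrite mulf_neq0// gt_eqF// subr_gt0.
rewrite /two_block /bound; congr (_ * _ ^+ _); last first.
  by field; rewrite d0 m0.
case: k k1 {tk u0 u1 d0} => // k _.
rewrite [k.+1.-1]/= expr_div_n [(1 - theta) ^+ k.+1]exprS.
by field; rewrite expf_neq0.
Qed.

(** With [X], [Y], [D1], [D2] the changes of the logarithms of [t], [u], [1 - t],
    [1 - u], Jensen's inequality bounds [D1] and [D2] below by means of [X] and
    [Y], hence the change of the logarithm of [two_block] above.  By
    [q theta = 0] this upper bound is [k theta X + m mu Y], which is nonpositive
    by Jensen's inequality for [k t + m u = 1]. *)
Lemma two_block_le {R : realType} (k m : nat) (theta t : R) : (1 < k)%N -> (1 < m)%N ->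
  q_zero k m theta -> 0 < t < k%:R^-1 -> two_block k m t <= two_block k m theta.
Proof.
move=> k1 m1 [thk qth] tk.
rewrite -ler_ln ?posrE ?two_block_gt0// !ln_two_block//.
have [t1 u0 u1] := two_block_bounds k m t k1 m1 tk.
have [th1 mu0 mu1] := two_block_bounds k m theta k1 m1 thk.
have /andP[t0 _] := tk; have /andP[th0 _] := thk.
have kR : (1 : R) < k%:R by rewrite ltr1n.
have mR : (1 : R) < m%:R by rewrite ltr1n.
move: qth u0 u1 mu0 mu1; rewrite q_factor.
set u := (1 - k%:R * t) / m%:R; set mu := (1 - k%:R * theta) / m%:R.
have : m%:R * u = 1 - k%:R * t by rewrite /u; field; rewrite gt_eqF//; lra.
have : m%:R * mu = 1 - k%:R * theta by rewrite /mu; field; rewrite gt_eqF//; lra.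
move: u mu (k%:R : R) (m%:R : R) kR mR {thk tk k1 m1} =>
  u mu K M K1 M1 Mmu Mu qth u0 u1 mu0 mu1.
have Km1 : 0 < K - 1 by lra.
have Mm1 : 0 < M - 1 by lra.
have K0 : 0 < K by lra.
have M0 : 0 < M by lra.
have J1 := ln_sum_ge2 _ _ _ _ _ _ Km1 M0 t0 u0 th0 mu0.
have J2 := ln_sum_ge2 _ _ _ _ _ _ K0 Mm1 t0 u0 th0 mu0.
have J3 := ln_sum_ge2 _ _ _ _ _ _ K0 M0 t0 u0 th0 mu0.
rewrite Mu Mmu in J1 J3.
have e1 (x : R) : (K - 1) * x + (1 - K * x) = 1 - x by ring.
have e3 (x : R) : K * x + (1 - K * x) = 1 by ring.
have e2 (x y : R) : M * y = 1 - K * x -> K * x + (M - 1) * y = 1 - y by lra.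
rewrite !e1 in J1; rewrite !e3 subrr mulr0 in J3.
rewrite (e2 _ _ Mu) (e2 _ _ Mmu) in J2.
move: J1 J2 J3.
set X := ln t - ln theta; set Y := ln u - ln mu.
set D1 := ln (1 - t) - ln (1 - theta); set D2 := ln (1 - u) - ln (1 - mu).
move=> J1 J2 J3.
suff : K * X + M * Y - (K - 1) * D1 - M * D2 <= 0 by rewrite /X /Y /D1 /D2; lra.
have th1' : 0 < 1 - theta by lra.
have mu1' : 0 < 1 - mu by lra.
have d0 : 0 < M - 1 + K * theta by nra.
have D1E : ((K - 1) * theta * X + (1 - K * theta) * Y) / (1 - theta) <= D1.
  by rewrite ler_pdivrMr// [D1 * _]mulrC.
have D2E : (K * theta * X + (M - 1) * mu * Y) / (1 - mu) <= D2.
  by rewrite ler_pdivrMr// [D2 * _]mulrC.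
have muE : mu = (1 - K * theta) / M by rewrite -Mmu; field; rewrite gt_eqF.
have d0' : M - (1 - K * theta) != 0 by rewrite gt_eqF//; lra.
(* The coefficients of X and Y once D1 and D2 are bounded below; the first
   identity is the equation q theta = 0, the second follows from it. *)
have aE : K - (K - 1) ^+ 2 * theta / (1 - theta) - M * K * theta / (1 - mu) = K * theta.
  apply/eqP; rewrite -subr_eq0; apply/eqP.
  transitivity (((K - theta) * (1 - K * theta) * (M - 1 + K * theta)
      - K * M ^+ 2 * theta * (1 - theta)) / ((1 - theta) * (M - 1 + K * theta))).
    by rewrite muE; field; rewrite !gt_eqF// lt0r d0'; lra.
  by rewrite qth mul0r.
have bE : M - (K - 1) * (M * mu) / (1 - theta) - M * ((M - 1) * mu) / (1 - mu) = M * mu.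
  apply/eqP; rewrite -subr_eq0; apply/eqP.
  transitivity (K * theta
      - (K - (K - 1) ^+ 2 * theta / (1 - theta) - M * K * theta / (1 - mu))).
    by rewrite muE; field; rewrite !gt_eqF// lt0r d0'; lra.
  by rewrite aE subrr.
apply: le_trans J3.
have -> : K * theta * X + (1 - K * theta) * Y = K * X + M * Y
    - (K - 1) * (((K - 1) * theta * X + (1 - K * theta) * Y) / (1 - theta))
    - M * ((K * theta * X + (M - 1) * mu * Y) / (1 - mu)).
  by rewrite -Mmu -{1}aE -{1}bE; field; rewrite !gt_eqF.
have := ler_wpM2l (ltW Km1) D1E; have := ler_wpM2l (ltW M0) D2E.
by lra.
Qed.

Lemma ratio_le_two_block {R : realType} (n k : nat) (x : 'I_n.+1 -> R) (t : R) :
  (1 < k)%N -> (k < n)%N -> (forall i, 0 < x i) -> \sum_i x i = 1 ->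
  k%:R * t = \sum_(i < n.+1 | (i < k)%N) x i ->
  0 < t < k%:R^-1 /\
  (\sum_(i < n.+1 | (i < k)%N) (1 - x i)) * \prod_i (x i / (1 - x i))
    <= two_block k (n.+1 - k)%N t.
Proof.
move=> k1 kn x0 sx st; have kn1 : (k <= n.+1)%N by rewrite ltnW// ltnS ltnW.
have [cP cQ] := card_ord_lt n.+1 k kn1; set m := (n.+1 - k)%N in cQ *.
have m1 : (1 < m)%N by rewrite /m ltn_subRL addn1 ltnS.
have k0 : (0 : R) < k%:R by rewrite ltr0n ltnW.
have m0 : (0 : R) < m%:R by rewrite ltr0n ltnW.
have n0 : (0 < n)%N by apply: leq_ltn_trans kn.
have pos (P : pred 'I_n.+1) i : P i -> 0 < \sum_(j | P j) x j.
  by move=> Pi; rewrite (bigD1 i)//= ltr_wpDr// sumr_ge0// => j _; exact: ltW.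
have x1 := lt1_of_sum1 x n0 x0 sx.
have t0 : 0 < t.
  by rewrite -(pmulr_rgt0 _ k0) st; apply: (pos _ ord0); rewrite /= ltnW.
have su : \sum_(i < n.+1 | ~~ (i < k)%N) x i = m%:R * ((1 - k%:R * t) / m%:R).
  rewrite mulrC divfK ?gt_eqF//; move: sx.
  rewrite (bigID (fun i : 'I_n.+1 => (i < k)%N))/= -st.
  by move=> /(canRL (addKr _)) ->; rewrite addrC.
have kt : k%:R * t < 1.
  rewrite -subr_gt0 -[1 - _](divfK (lt0r_neq0 m0)) mulrC -su.
  by apply: (pos _ ord_max); rewrite /= -leqNgt ltnW.
have tk : 0 < t < k%:R^-1 by rewrite t0 -[k%:R^-1]mulr1 ltr_pdivlMl.
split=> //; have [t1 u0 u1] := two_block_bounds k m t k1 m1 tk.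
have sE : \sum_(i < n.+1 | (i < k)%N) (1 - x i) = k%:R * (1 - t).
  by rewrite sumrB -st sumr_const cP; ring.
have q0 i : 0 < x i / (1 - x i) by rewrite divr_gt0 ?subr_gt0.
rewrite sE -ler_ln ?posrE ?two_block_gt0 ?mulr_gt0 ?prodr_gt0 ?subr_gt0//.
rewrite ln_two_block// lnM ?posrE ?mulr_gt0 ?prodr_gt0 ?subr_gt0//.
rewrite lnM ?posrE ?subr_gt0// -[leRHS]addrA lerD2l ln_prod//.
under eq_bigr => i _ do rewrite ln_div ?posrE ?subr_gt0//.
rewrite (bigID (fun i : 'I_n.+1 => (i < k)%N))/=; apply: lerD.
  have := sum_logit_le_mean [pred i : 'I_n.+1 | (i < k)%N] x t.
  by rewrite cP; apply => //; rewrite ltnW.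
have := sum_logit_le_mean [pred i : 'I_n.+1 | ~~ (i < k)%N] x ((1 - k%:R * t) / m%:R).
by rewrite cQ; apply => //; rewrite ltnW.
Qed.

Lemma ratio_two_block {R : realType} (n k : nat) (t : R) (x : 'I_n.+1 -> R) :
  (k <= n.+1)%N ->
  (forall i, x i = if (i < k)%N then t else (1 - k%:R * t) / (n.+1 - k)%:R) ->
  (\sum_(i < n.+1 | (i < k)%N) (1 - x i)) * \prod_i (x i / (1 - x i))
    = two_block k (n.+1 - k)%N t.
Proof.
move=> kn xE; have [cP cQ] := card_ord_lt n.+1 k kn.
rewrite (eq_bigr (fun=> 1 - t)) => [|i ik]; last by rewrite xE ik.
rewrite sumr_const cP -[_ *+ k]mulr_natl (bigID (fun i : 'I_n.+1 => (i < k)%N))/=.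
rewrite (eq_bigr (fun=> t / (1 - t))) => [|i ik]; last by rewrite xE ik.
rewrite prodr_const cP [X in _ * (_ * X)](eq_bigr (fun=> (1 - k%:R * t) / (n.+1 - k)%:R
   / (1 - (1 - k%:R * t) / (n.+1 - k)%:R))) => [|i /negPf ik]; last by rewrite xE ik.
by rewrite prodr_const cQ /two_block mulrA.
Qed.

(** * The ratio of volumes *)

(** The ratio of volumes in terms of the barycentric coordinates of [M]. *)
Lemma volume_ratio_barycentric {R : realType} (n k : nat)
    (A : 'I_n.+1 -> 'rV[R]_n) (lam : 'I_n.+1 -> R) (M : 'rV[R]_n)
    (N : 'I_n.+1 -> 'rV[R]_n) :
  (0 < n)%N -> affinely_independent A -> (forall i, 0 < lam i) ->
  barycentric A lam M -> cevian_feet A M N ->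
  volume_ratio k A M N =
    (\sum_(i < n.+1 | (i < k)%N) (1 - lam i)) * \prod_i (lam i / (1 - lam i)).
Proof.
move=> n0 indA l0 lamM feet.
have l1 := lt1_of_sum1 lam n0 l0 lamM.1.
rewrite /volume_ratio mulr_suml [RHS]mulr_suml; apply: eq_bigr => i _.
have dC := det_cevian_mx lam i l0 l1.
rewrite -dC; apply: simplex_vol_ratio => //.
  rewrite -normr_gt0 dC mulr_gt0 ?prodr_gt0 ?subr_gt0// => j _.
  by rewrite divr_gt0 ?subr_gt0.
move=> j; have [ji|ji] := eqVneq j i.
  rewrite /cevian_subsimplex ji eqxx; case: lamM => [sl defM]; split.
    by rewrite -[RHS]sl; apply: eq_bigr => l _; rewrite mxE eqxx.
  by rewrite {1}defM; apply: eq_bigr => l _; rewrite mxE eqxx.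
have [Nj cNj] := feet j.
have lj : lam j != 1 by rewrite lt_eqF.
have [s1 defN] := barycentric_foot A lam M (N j) j indA lamM lj Nj cNj.
rewrite /cevian_subsimplex (negPf ji); split.
  by rewrite -[RHS]s1; apply: eq_bigr => l _; rewrite mxE (negPf ji).
by rewrite {1}defN; apply: eq_bigr => l _; rewrite mxE (negPf ji).
Qed.

Theorem theorem1 (R : realType) (n : nat) (hn : (2 <= n)%N)
    (A : 'I_n.+1 -> 'rV[R]_n) (hA : affinely_independent A)
    (k : nat) (hk : (1 < k < n)%N) :
  let m := (n.+1 - k)%N in
  (exists! theta : R, q_zero k m theta) /\
  forall theta : R, q_zero k m theta ->
    (forall (M : 'rV[R]_n) (N : 'I_n.+1 -> 'rV[R]_n),
       interior (simplex A) M -> cevian_feet A M N ->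
       volume_ratio k A M N <= bound k m theta) /\
    (forall (M : 'rV[R]_n) (N : 'I_n.+1 -> 'rV[R]_n),
       barycentric A (fun i => if (i < k)%N then theta
                               else (1 - k%:R * theta) / m%:R) M ->
       cevian_feet A M N ->
       volume_ratio k A M N = bound k m theta).
Proof.
move=> m; have /andP[k1 kn] := hk.
have m1 : (1 < m)%N by rewrite /m ltn_subRL addn1 ltnS.
have n0 : (0 < n)%N by apply: leq_ltn_trans kn.
have k0 : (0 : R) < k%:R by rewrite ltr0n ltnW.
split; first exact: q_zero_unique.
move=> theta th; have [thk _] := th; split=> M N.
  move=> intM feet; have [lam l0 lamM] := barycentric_interior A M n0 hA intM.
  rewrite (volume_ratio_barycentric n k A lam M N n0 hA l0 lamM feet).
  pose t := k%:R^-1 * \sum_(i < n.+1 | (i < k)%N) lam i.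
  have st : k%:R * t = \sum_(i < n.+1 | (i < k)%N) lam i.
    by rewrite /t mulVKf// gt_eqF.
  have [tk le] := ratio_le_two_block n k lam t k1 kn l0 lamM.1 st.
  by apply: le_trans le _; rewrite -two_block_bound//; exact: two_block_le.
set lam := (X in barycentric A X M) => lamM feet.
have [_ u0 _] := two_block_bounds k m theta k1 m1 thk.
have l0 i : 0 < lam i by rewrite /lam; case: ifP => // _; case/andP: thk.
rewrite (volume_ratio_barycentric n k A lam M N n0 hA l0 lamM feet).
rewrite (ratio_two_block n k theta lam)//; first exact: two_block_bound.
by rewrite ltnW// ltnS ltnW.
Qed.
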